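(* Let $G$ be the complement of the line graph of a (finite, loopless) triangle-free multigraph. Then $\mathrm{had}_2(G) \geq \chi(G)$.
   Context: Graphs are finite, loopless and without parallel edges; multigraphs are finite and loopless but may have parallel edges. A multigraph is triangle-free if it has no three pairwise adjacent distinct vertices. The line graph of a multigraph $M$ is the simple graph whose vertices are the edges of $M$, two distinct edges being adjacent if and only if they share at least one endpoint (in particular, parallel edges are adjacent). $\chi(G)$ denotes the chromatic number of $G$. An $H$-model in a graph $G$ is a collection $\{S_x : x\in V(H)\}$ of pairwise disjoint non-empty connected subsets of $V(G)$ (each $S_x$ induces a connected subgraph of $G$) such that there is an edge of $G$ between a vertex of $S_x$ and a vertex of $S_y$ whenever $xy\in E(H)$; the sets $S_x$ are called branch sets. An $H$-model is small if every branch set has size $1$ or $2$. $\mathrm{had}_2(G)$ is the maximum integer $t$ such that $G$ has a small $K_t$-model. *)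

(* Defs.v *)
From mathcomp Require Import all_boot.

Set Implicit Arguments.
Unset Strict Implicit.
Unset Printing Implicit Defensive.

Record sgraph := SGraph {
  vertex :> finType;
  adj : rel vertex;
  adj_sym : symmetric adj;
  adj_irrefl : irreflexive adj
}.

(* Every edge has a set of exactly two endpoints (no loops); [ends] need not be
   injective, so parallel edges are allowed. *)
Record multigraph := Multigraph {
  mvertex : finType;
  medge : finType;
  ends : medge -> {set mvertex};
  card_ends : forall e, #|ends e| = 2
}.

Definition madj (M : multigraph) : rel (mvertex M) :=
  [rel x y | [exists e : medge M, ends e == [set x; y]]].

Definition triangle_free (M : multigraph) : Prop :=
  ~ exists x y z : mvertex M,
      [/\ [&& x != y, y != z & x != z], madj x y, madj y z & madj x z].

Definition line_adj (M : multigraph) : rel (medge M) :=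
  [rel e f | (e != f) && (ends e :&: ends f != set0)].

Lemma line_adj_sym M : symmetric (@line_adj M).
Proof. by move=> e f; rewrite /line_adj /= eq_sym setIC. Qed.

Lemma line_adj_irrefl M : irreflexive (@line_adj M).
Proof. by move=> e; rewrite /line_adj /= eqxx. Qed.

Definition line_graph (M : multigraph) : sgraph :=
  SGraph (@line_adj_sym M) (@line_adj_irrefl M).

Definition compl_adj (G : sgraph) : rel G := [rel x y | (x != y) && ~~ adj x y].

Lemma compl_adj_sym G : symmetric (@compl_adj G).
Proof. by move=> x y; rewrite /compl_adj /= eq_sym adj_sym. Qed.

Lemma compl_adj_irrefl G : irreflexive (@compl_adj G).
Proof. by move=> x; rewrite /compl_adj /= eqxx. Qed.

Definition complement (G : sgraph) : sgraph :=
  SGraph (@compl_adj_sym G) (@compl_adj_irrefl G).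

Definition complete_adj (t : nat) : rel 'I_t := [rel i j | i != j].

Lemma complete_adj_sym t : symmetric (@complete_adj t).
Proof. by move=> i j; rewrite /complete_adj /= eq_sym. Qed.

Lemma complete_adj_irrefl t : irreflexive (@complete_adj t).
Proof. by move=> i; rewrite /complete_adj /= eqxx. Qed.

Definition complete (t : nat) : sgraph :=
  SGraph (@complete_adj_sym t) (@complete_adj_irrefl t).

Definition proper_coloring (G : sgraph) (k : nat) (c : {ffun G -> 'I_k}) : bool :=
  [forall x : G, forall y : G, adj x y ==> (c x != c y)].

Definition colorable (G : sgraph) (k : nat) : bool :=
  [exists c : {ffun G -> 'I_k}, proper_coloring c].

Lemma colorable_card G : colorable G #|G|.
Proof.
apply/existsP; exists [ffun x : G => enum_rank x].
apply/forallP=> x; apply/forallP=> y; apply/implyP=> xy.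
rewrite !ffunE (inj_eq enum_rank_inj).
by apply: contraTneq xy => ->; rewrite adj_irrefl.
Qed.

Lemma ex_colorable G : exists k, colorable G k.
Proof. by exists #|G|; apply: colorable_card. Qed.

Definition chromatic_number (G : sgraph) : nat := ex_minn (ex_colorable G).

Definition connected_in (G : sgraph) (S : {set G}) : bool :=
  [forall x in S, forall y in S,
     connect [rel u v | [&& u \in S, v \in S & adj u v]] x y].

Definition is_model (H G : sgraph) (S : {ffun H -> {set G}}) : bool :=
  [&& [forall x, (S x != set0) && connected_in (S x)],
      [forall x, forall y, (x != y) ==> [disjoint S x & S y]] &
      [forall x, forall y, adj x y ==>
         [exists u in S x, exists v in S y, adj u v]]].

Definition is_small (H G : sgraph) (S : {ffun H -> {set G}}) : bool :=
  [forall x, (#|S x| == 1) || (#|S x| == 2)].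

Definition has_small_model (H G : sgraph) : bool :=
  [exists S : {ffun H -> {set G}}, is_model S && is_small S].

Lemma ex_small_complete_model G : exists t, has_small_model (complete t) G.
Proof.
exists 0; apply/existsP; exists [ffun => set0].
by rewrite /is_model /is_small; apply/andP; split;
  [apply/and3P; split|]; apply/forallP; case.
Qed.

Lemma small_complete_model_bound G t :
  has_small_model (complete t) G -> t <= #|G|.
Proof.
case/existsP=> S /andP[/and3P[/forallP S0 /forallP Sd _] _].
have ne (i : 'I_t) : exists x, x \in S i.
  by apply/set0Pn; case/andP: (S0 i).
pose f (i : 'I_t) := xchoose (ne i).
have f_inj : injective f.
  move=> i j fij; apply: contraTeq (xchooseP (ne i)) => ij.
  have /implyP/(_ ij) dij := forallP (Sd i) j.
  by apply: contraTN (xchooseP (ne j)) => fi; rewrite -/(f j) -fij (disjointFr dij).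
by have := leq_card f f_inj; rewrite card_ord.
Qed.

Definition had2 (G : sgraph) : nat :=
  ex_maxn (ex_small_complete_model G) (@small_complete_model_bound G).

(* Main.v *)
Require Import Defs.
From mathcomp Require Import all_boot zify.

Set Implicit Arguments.
Unset Strict Implicit.
Unset Printing Implicit Defensive.

(** Two vertices of G, the complement of the line graph of M, are adjacent
    exactly when they are disjoint edges of M.  The edges at a vertex of M thus
    form a stable set of G, so a vertex cover of size k gives a k-colouring of
    G ([cover_colorable]).  It therefore suffices to exhibit a vertex cover T of
    M and a small complete model in G with at least |T| branch sets.  The branch
    sets are single edges and pairs of disjoint edges of M; a family of them,
    disjoint and with a disjoint pair of edges between any two members, is
    called a system ([system_model]).

    T and the system are built together, by induction on a set A of vertices
    spanning the edges under consideration ([cover_system]).  Write N(v) for the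
    neighbourhood of v in A.

    If N(v) is empty, v may be dropped.  If N(v) = {u}, remove u and v, put u
    into T and add the single branch uv, which is disjoint from every edge that
    remains ([remove_leaf]).

    If v has at least three neighbours, remove v, put it into T, and enlarge the
    system of A - v by one branch ([add_high_degree]).  What makes this possible
    is that an edge vx never conflicts with a pair of the smaller system: v lies
    on no edge of that pair and x lies on at most one.  Only the single branch
    at x can be in the way.  When some neighbour x lies on no single branch,
    {vx} is a new branch.  Otherwise let e_x be the single branch at x; as there
    are no triangles, the edges e_x are distinct, hence pairwise disjoint.  If
    some branch is a pair {g, h}, it can be exchanged for {vx, g} and {vy, h},
    where x and y are different neighbours with e_x disjoint from g and e_y
    disjoint from h ([swap_branch]).  If all branches are single, let f be
    another edge at the far end of e_1; since f meets e_1, it is disjoint from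
    e_i for i = 2 or i = 3.  With k the other one of these two indices, the
    branches e_1 and e_k can be exchanged for the three branches {vx_i, f},
    {vx_k, e_1} and {vx_1, e_k} ([triple_branch]).

    In the remaining case every vertex has exactly two neighbours.  The first
    vertex of a longest path is joined to a later vertex of it, which closes a
    cycle ([ex_cycle]), and no edge leaves this cycle.  A cycle with n edges
    E_0, ..., E_(n-1), n > 3, is covered by half of its vertices, rounded up
    ([cycle_cover]), and has a system of the same size ([cycle_system]): the
    edges of even index when n is even; E_0 and the pairs {E_i, E_(i+k)} with
    0 < i <= k when n = 2k + 1. *)

(** * Branches and systems *)

Definition apart (M : multigraph) : rel (medge M) :=
  [rel e f | [disjoint ends e & ends f]].

(** A set of one or two edges; the single edge [e] is the pair [(e, e)], so that
    both sizes are handled by the same formulas. *)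
Notation branch M := (medge M * medge M)%type.

Definition branch_in (M : multigraph) (A : {set mvertex M}) (b : branch M) :=
  [&& ends b.1 \subset A, ends b.2 \subset A & (b.1 == b.2) || apart b.1 b.2].

Definition compat (M : multigraph) : rel (branch M) :=
  [rel b c | [&& b.1 != c.1, b.1 != c.2, b.2 != c.1, b.2 != c.2 &
     [|| apart b.1 c.1, apart b.1 c.2, apart b.2 c.1 | apart b.2 c.2]]].

Definition system (M : multigraph) (A : {set mvertex M}) (q : {set branch M}) :=
  (forall b, b \in q -> branch_in A b) /\
  (forall b c, b \in q -> c \in q -> b != c -> compat b c).

Definition covers (M : multigraph) (A T : {set mvertex M}) :=
  forall e : medge M, ends e \subset A -> exists2 x, x \in T & x \in ends e.

Lemma apartC M (e f : medge M) : apart e f = apart f e.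
Proof. exact: disjoint_sym. Qed.

Lemma apart_neq M (e f : medge M) : apart e f -> e != f.
Proof.
apply: contraTneq => ->; rewrite /apart /= -setI_eq0 setIid -card_gt0.
by rewrite card_ends.
Qed.

Lemma ends_neq M (e f : medge M) x : x \in ends e -> x \notin ends f -> e != f.
Proof. by move=> xe; apply: contraNneq => <-. Qed.

Lemma disjoints2 (T : finType) (A : {set T}) x y :
  [disjoint [set x; y] & A] = (x \notin A) && (y \notin A).
Proof. by rewrite -setI_eq0 setIUl setU_eq0 !setI_eq0 !disjoints1. Qed.

Lemma sub2set (T : finType) (A : {set T}) x y :
  ([set x; y] \subset A) = (x \in A) && (y \in A).
Proof. by rewrite subUset !sub1set. Qed.

Lemma apart2 M (e f : medge M) x y :
  ends e = [set x; y] -> apart e f = (x \notin ends f) && (y \notin ends f).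
Proof. by move=> De; rewrite /apart /= De disjoints2. Qed.

Lemma apartF M (e f : medge M) x : apart e f -> x \in ends e -> x \notin ends f.
Proof. by move=> ef xe; rewrite (disjointFr ef xe). Qed.

Lemma compatC M (b c : branch M) : compat b c = compat c b.
Proof.
case: b c => [e f] [g h]; rewrite /compat /=.
rewrite !(eq_sym g) !(eq_sym h) !(apartC g) !(apartC h).
by do !case: (_ != _) => //=; do !case: apart.
Qed.

Lemma compat_irr M (b : branch M) : compat b b = false.
Proof. by rewrite /compat /= eqxx. Qed.

Lemma single_apart M A (q : {set branch M}) e f :
  system A q -> (e, e) \in q -> (f, f) \in q -> e != f -> apart e f.
Proof.
move=> [_ qc] eq fq ef; have: compat (e, e) (f, f).
  by apply: qc => //; apply: contraNneq ef => -[->].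
by case/and5P=> _ _ _ _ /=; rewrite !orbb.
Qed.

Lemma systemU1 M A (q : {set branch M}) b :
    system A q -> branch_in A b -> (forall c, c \in q -> compat b c) ->
  system A (b |: q) /\ #|b |: q| = #|q|.+1.
Proof.
move=> [qA qc] bA bc; split; last first.
  rewrite cardsU1; case: (boolP (b \in q)) => // /bc.
  by rewrite compat_irr.
split=> [c|c d]; first by case/setU1P=> [->|/qA].
case/setU1P=> [->|cq] /setU1P[->|dq] ; rewrite ?eqxx // => cd.
- exact: bc.
- by rewrite compatC bc.
- exact: qc.
Qed.

Lemma sub_system M (A B : {set mvertex M}) (p q : {set branch M}) :
  A \subset B -> p \subset q -> system A q -> system B p.
Proof.
move=> sAB /subsetP spq [qA qc]; split=> [b|b c /spq bq /spq cq].
  case/spq/qA/and3P=> b1 b2 bb.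
  by rewrite /branch_in bb !(subset_trans _ sAB).
exact: qc.
Qed.

Lemma system0 M (A : {set mvertex M}) : system A (set0 : {set branch M}).
Proof. by split=> b; rewrite inE. Qed.

Lemma branch_in_avoid M (A : {set mvertex M}) v (b : branch M) :
  branch_in (A :\ v) b -> v \notin ends b.1 /\ v \notin ends b.2.
Proof.
case/and3P=> /subsetP b1 /subsetP b2 _.
by split; apply/negP; [move/b1|move/b2]; rewrite !inE eqxx.
Qed.

Lemma systemU M (A B : {set mvertex M}) (p q : {set branch M}) :
    [disjoint A & B] -> system A p -> system B q ->
  system (A :|: B) (p :|: q) /\ #|p :|: q| = #|p| + #|q|.
Proof.
move=> dAB [pA pc] [qB qc].
have ap (e f : medge M) : ends e \subset A -> ends f \subset B -> apart e f.
  by move=> eA fB; exact: disjointWl eA (disjointWr fB dAB).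
have cpq b c : b \in p -> c \in q -> compat b c.
  move=> /pA/and3P[b1 b2 _] /qB/and3P[c1 c2 _].
  by rewrite /compat /= ap // !apart_neq // ap.
split; last first.
  rewrite cardsU; suff -> : p :&: q = set0 by rewrite cards0 subn0.
  apply/setP=> b; rewrite !inE; apply/andP=> [[bp bq]].
  by have := cpq b b bp bq; rewrite compat_irr.
split=> [b|b c].
  case/setUP=> [/pA|/qB] /and3P[b1 b2 bb]; rewrite /branch_in bb andbT.
    by rewrite !(subset_trans _ (subsetUl A B)).
  by rewrite !(subset_trans _ (subsetUr A B)).
case/setUP=> bq /setUP[]cq bc; [exact: pc | exact: cpq | | exact: qc].
by rewrite compatC cpq.
Qed.

(** * Neighbourhoods *)

Definition nbrs M (A : {set mvertex M}) v := [set u in A | madj v u].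

Lemma madjC M (x y : mvertex M) : madj x y = madj y x.
Proof. by rewrite /madj /= setUC. Qed.

Lemma madjP M (x y : mvertex M) :
  reflect (exists e : medge M, ends e = [set x; y]) (madj x y).
Proof. exact: 'exists_eqP. Qed.

Lemma madj_neq M (x y : mvertex M) : madj x y -> x != y.
Proof.
case/madjP=> e De; apply/eqP=> xy; have := card_ends e.
by rewrite De xy setUid cards1.
Qed.

Lemma madj_ends M (e : medge M) x y : x \in ends e -> y \in ends e -> x != y ->
  ends e = [set x; y].
Proof.
move=> xe ye xy; apply/esym/eqP; rewrite eqEcard card_ends cards2 xy andbT.
by rewrite sub2set xe ye.
Qed.

Lemma other_end M (e : medge M) x :
  x \in ends e -> exists2 y, ends e = [set x; y] & madj x y.
Proof.
move=> xe; have /cards2P[a [b [_ De]]] : #|ends e| == 2 by rewrite card_ends.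
have ex c : ends e = [set x; c] -> exists2 y, ends e = [set x; y] & madj x y.
  by move=> Dc; exists c; last by apply/madjP; exists e.
have: x \in [set a; b] by rewrite -De.
case/set2P=> Dx.
  by apply: (ex b); rewrite Dx De.
by apply: (ex a); rewrite Dx De setUC.
Qed.

Lemma no_triangle M : triangle_free M ->
  forall x y z : mvertex M, madj x y -> madj y z -> madj x z -> False.
Proof.
move=> tf x y z xy yz xz; apply: tf; exists x, y, z; split=> //.
by rewrite !madj_neq.
Qed.

(** * Vertices with at most one neighbour *)

Lemma remove_isolated M (A T : {set mvertex M}) v :
  nbrs A v = set0 -> covers (A :\ v) T -> covers A T.
Proof.
move=> N0 cT e eA; apply: cT; apply/subsetP=> x xe.
rewrite !inE (subsetP eA) // andbT.
apply/eqP=> xv; rewrite xv in xe.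
have [y De vy] := other_end xe.
by move/setP/(_ y): N0; rewrite !inE vy (subsetP eA) // De set22.
Qed.

Lemma remove_leaf M (A T : {set mvertex M}) u v q :
    v \in A -> nbrs A v = [set u] ->
    covers (A :\: [set u; v]) T -> system (A :\: [set u; v]) q ->
  covers A (u |: T) /\ exists2 q', system A q' & #|q'| = #|q|.+1.
Proof.
move=> vA Nv cT sq; have: u \in nbrs A v by rewrite Nv set11.
rewrite inE => /andP[uA vu]; split=> [e eA|].
  have [ue|uNe] := boolP (u \in ends e); first by exists u; rewrite ?setU11.
  have [|x xT xe] := cT e; last by exists x; rewrite // setU1r.
  rewrite subsetD eA disjoint_sym disjoints2 uNe /=.
  apply/negP=> ve; have [y De vy] := other_end ve.
  have: y \in nbrs A v by rewrite inE vy (subsetP eA) // De set22.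
  by rewrite Nv inE => /eqP yu; rewrite De yu set22 in uNe.
have [a Da] := madjP _ _ vu.
have sa : system [set u; v] [set (a, a)].
  split=> [b /set1P->|b c /set1P-> /set1P->]; rewrite ?eqxx //.
  by rewrite /branch_in /= eqxx Da setUC subxx.
have dA : [disjoint [set u; v] & A :\: [set u; v]].
  by rewrite -setI_eq0 setIDA setIC -setIDA setDv setI0.
have [s c] := systemU dA sa sq.
exists ([set (a, a)] :|: q); last by rewrite c cards1.
apply: sub_system s => //; apply/subsetP=> x; rewrite !inE.
by case/orP=> [/orP[]/eqP->|/andP[]].
Qed.

(** * Vertices with at least three neighbours *)

(** The second end [x] of [a] cannot lie on both edges of a pair, so only a
    single branch at [x] can meet [a]. *)
Lemma top_edge M (A : {set mvertex M}) v x a (b : branch M) :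
    ends a = [set v; x] -> branch_in (A :\ v) b ->
  [|| apart a b.1, apart a b.2 | (b.1 == b.2) && (x \in ends b.1)].
Proof.
move=> Da bA; have [v1 v2] := branch_in_avoid bA.
rewrite !(apart2 _ Da) v1 v2 /=; case/and3P: bA => _ _ /orP[/eqP->|b12].
  by rewrite eqxx; case: (x \in _).
have := apartF b12 (x := x); by case: (x \in ends b.1) => //= /(_ isT) ->.
Qed.

(** Hence the branch [(a, g)], with [a] an edge at the new vertex [v], fits into
    a system avoiding [v] as soon as [g] is apart from the single branch at the
    other end of [a]. *)
Lemma compat_top M (A : {set mvertex M}) v x a g (b : branch M) :
    ends a = [set v; x] -> branch_in (A :\ v) b -> g != b.1 -> g != b.2 ->
    (b.1 = b.2 -> x \in ends b.1 -> apart b.1 g) ->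
  compat (a, g) b.
Proof.
move=> Da bA g1 g2 bx; have [v1 v2] := branch_in_avoid bA.
have va : v \in ends a by rewrite Da set21.
rewrite /compat /= g1 g2 (ends_neq va v1) (ends_neq va v2) /=.
case/or3P: (top_edge Da bA) => [->|->|/andP[/eqP b12 xb]] //.
  by rewrite orbT.
by rewrite !(apartC g) bx // !orbT.
Qed.

(** The pair [(g, h)] is traded for [(a, g)] and [(b, h)].  These are compatible
    with each other because [g] and [h] are disjoint. *)
Lemma swap_branch M (A : {set mvertex M}) v q g h x y a b :
    v \in A -> x \in A -> y \in A -> x != y ->
    system (A :\ v) q -> (g, h) \in q -> g != h ->
    ends a = [set v; x] -> ends b = [set v; y] ->
    x \notin ends g -> y \notin ends h ->
    (forall e, (e, e) \in q -> x \in ends e -> apart e g) ->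
    (forall e, (e, e) \in q -> y \in ends e -> apart e h) ->
  exists2 q', system A q' & #|q'| = #|q|.+1.
Proof.
move=> vA xA yA xy sq ghq gh Da Db xg yh eg eh.
have [qA qc] := sq.
have /and3P[/= gA hA] := qA _ ghq; rewrite (negPf gh) /= => apgh.
have [/= vg vh] := branch_in_avoid (qA _ ghq).
pose q0 := q :\ (g, h).
have s0 : system A q0 by apply: sub_system sq; rewrite ?subsetDl.
have cmp c : c \in q0 -> [/\ c \in q, branch_in (A :\ v) c & compat (g, h) c].
  by case/setD1P=> c_gh cq; split; rewrite ?qA ?qc // eq_sym.
have [] := @systemU1 _ _ _ (b, h) s0.
- rewrite /branch_in /= Db sub2set vA yA (subset_trans hA) ?subsetDl //=.
  by rewrite (apart2 _ Db) vh yh orbT.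
- move=> c /cmp[cq cA /and5P[_ _ h1 h2 _]].
  apply: compat_top Db cA h1 h2 _ => c12 yc; apply: eh => //.
  by rewrite {2}c12 -surjective_pairing.
move=> s1 n1; have [] := @systemU1 _ _ _ (a, g) s1.
- rewrite /branch_in /= Da sub2set vA xA (subset_trans gA) ?subsetDl //=.
  by rewrite (apart2 _ Da) vg xg orbT.
- move=> c /setU1P[->|/cmp[cq cA /and5P[g1 g2 _ _ _]]].
    have va : v \in ends a by rewrite Da set21.
    have vb : v \in ends b by rewrite Db set21.
    rewrite /compat /= gh apgh !orbT (ends_neq va vh) /= (eq_sym g).
    rewrite (ends_neq vb vg) !andbT; apply: (@ends_neq _ _ _ x).
      by rewrite Da set22.
    rewrite Db !inE (negPf xy) orbF.
    by rewrite eq_sym; apply: (@madj_neq M); apply/madjP; exists a.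
  apply: compat_top Da cA g1 g2 _ => c12 xc; apply: eg => //.
  by rewrite {2}c12 -surjective_pairing.
move=> s2 n2; exists ((a, g) |: ((b, h) |: q0)) => //.
by rewrite n2 n1 (cardsD1 (g, h) q) ghq.
Qed.

Lemma add_single M (A : {set mvertex M}) v q x a :
    v \in A -> x \in A -> system (A :\ v) q -> ends a = [set v; x] ->
    (forall e, (e, e) \in q -> x \notin ends e) ->
  exists2 q', system A q' & #|q'| = #|q|.+1.
Proof.
move=> vA xA sq Da ex; have [qA _] := sq.
have s0 : system A q by apply: sub_system sq; rewrite ?subsetDl.
have va : v \in ends a by rewrite Da set21.
have [] := @systemU1 _ _ _ (a, a) s0.
- by rewrite /branch_in /= eqxx Da andbT andbb sub2set vA xA.
- move=> c cq; have [v1 v2] := branch_in_avoid (qA _ cq).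
  apply: compat_top Da (qA _ cq) _ _ _; rewrite ?(ends_neq va) // => c12 xc.
  by move: (ex c.1); rewrite {2}c12 -surjective_pairing xc; case/(_ cq)/negP.
by move=> s n; exists ((a, a) |: q).
Qed.

(** The single branches [e1] and [e2] are traded for [(a, f)], [(a2, e1)] and
    [(a1, e2)].  The last two are compatible because [e1] and [e2] are disjoint,
    and both are compatible with the first because [a] meets neither [e1] nor
    [e2]. *)
Lemma triple_branch M (A : {set mvertex M}) v q f x x1 x2 a a1 a2 e1 e2 :
    v \in A -> x \in A -> x1 \in A -> x2 \in A -> x1 != x2 ->
    x1 != x -> x2 != x ->
    system (A :\ v) q -> (e1, e1) \in q -> (e2, e2) \in q ->
    (forall b, b \in q -> b.1 = b.2) ->
    ends f \subset A :\ v -> (f, f) \notin q ->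
    ends a = [set v; x] -> ends a1 = [set v; x1] -> ends a2 = [set v; x2] ->
    x1 \in ends e1 -> x2 \in ends e2 ->
    e1 != e2 -> x \notin ends e1 -> x \notin ends e2 ->
    x \notin ends f ->
    (forall e, (e, e) \in q -> x \in ends e -> apart e f) ->
  exists2 q', system A q' & #|q'| = #|q|.+1.
Proof.
move=> vA xA x1A x2A x12 x1x x2x sq e1q e2q single fA fq.
move=> Da Da1 Da2 xe1 xe2 e12 xNe1 xNe2 xf ef.
have [qA qc] := sq.
have ap12 := single_apart sq e1q e2q e12.
have [/= ve1 _] := branch_in_avoid (qA _ e1q).
have [/= ve2 _] := branch_in_avoid (qA _ e2q).
have vf : v \notin ends f by apply/negP=> /(subsetP fA); rewrite !inE eqxx.
have /and3P[/= e1A _ _] := qA _ e1q; have /and3P[/= e2A _ _] := qA _ e2q.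
have x1e2 := apartF ap12 xe1.
have x2e1 : x2 \notin ends e1.
  by rewrite apartC in ap12; exact: apartF ap12 xe2.
pose q0 := q :\ (e1, e1) :\ (e2, e2).
have s0 : system A q0.
  apply: sub_system sq; first exact: subsetDl.
  exact: subset_trans (subsetDl _ _) (subsetDl _ _).
have cmp c : c \in q0 ->
    [/\ c \in q, branch_in (A :\ v) c, c.1 = c.2, apart e1 c.1 & apart e2 c.1].
  case/setD1P=> c2 /setD1P[c1 cq]; have cc := single _ cq.
  have cE : c = (c.1, c.1) by rewrite {2}cc -surjective_pairing.
  rewrite qA // !(single_apart sq) // -?cE //.
    by apply: contraNneq c2 => e2c; rewrite cE -e2c.
  by apply: contraNneq c1 => e1c; rewrite cE -e1c.
have va : v \in ends a by rewrite Da set21.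
have va1 : v \in ends a1 by rewrite Da1 set21.
have va2 : v \in ends a2 by rewrite Da2 set21.
have xNv (y : mvertex M) (d : medge M) : ends d = [set v; y] -> y != v.
  by move=> Dd; rewrite eq_sym (@madj_neq M) //; apply/madjP; exists d.
have aneq (y z : mvertex M) (d d' : medge M) :
    ends d = [set v; y] -> ends d' = [set v; z] -> y != z -> d != d'.
  move=> Dd Dd' yz; apply: (@ends_neq _ _ _ y); first by rewrite Dd set22.
  by rewrite Dd' !inE (negPf yz) orbF (xNv _ d).
have [] := @systemU1 _ _ _ (a1, e2) s0.
- rewrite /branch_in /= Da1 sub2set vA x1A (subset_trans e2A) ?subsetDl //=.
  by rewrite (apart2 _ Da1) ve2 x1e2 orbT.
- move=> c /cmp[cq cA cc ap1 ap2].
  have c2 := apart_neq ap2.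
  by apply: compat_top Da1 cA _ _ _; rewrite -?cc // => _ _; rewrite apartC.
move=> s1 n1; have [] := @systemU1 _ _ _ (a2, e1) s1.
- rewrite /branch_in /= Da2 sub2set vA x2A (subset_trans e1A) ?subsetDl //=.
  by rewrite (apart2 _ Da2) ve1 x2e1 orbT.
- move=> c /setU1P[->|/cmp[cq cA cc ap1 ap2]].
    rewrite /compat /= ap12 !orbT e12 (ends_neq va2 ve2) /= (eq_sym e1).
    by rewrite (ends_neq va1 ve1) !andbT (aneq x2 x1) // eq_sym.
  have c1 := apart_neq ap1.
  by apply: compat_top Da2 cA _ _ _; rewrite -?cc // => _ _; rewrite apartC.
have fNe e : (e, e) \in q -> f != e by apply: contraTneq => <-.
have [f1 f2] := (fNe _ e1q, fNe _ e2q).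
have apa e : v \notin ends e -> x \notin ends e -> apart a e.
  by rewrite (apart2 _ Da) => -> ->.
move=> s2 n2; have [] := @systemU1 _ _ _ (a, f) s2.
- rewrite /branch_in /= Da sub2set vA xA (subset_trans fA) ?subsetDl //=.
  by rewrite (apart2 _ Da) vf xf orbT.
- move=> c /setU1P[->|/setU1P[->|/cmp[cq cA cc ap1 ap2]]].
  + rewrite /compat /= f1 (apa e1) // !orbT (ends_neq va ve1) /= (eq_sym f).
    by rewrite (ends_neq va2 vf) !andbT (aneq x x2) // eq_sym.
  + rewrite /compat /= f2 (apa e2) // !orbT (ends_neq va ve2) /= (eq_sym f).
    by rewrite (ends_neq va1 vf) !andbT (aneq x x1) // eq_sym.
  have cE : (c.1, c.1) \in q by rewrite {2}cc -surjective_pairing.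
  have fc := fNe _ cE.
  by apply: compat_top Da cA _ _ _; rewrite -?cc // => _ xc; apply: ef.
move=> s3 n3; exists ((a, f) |: ((a2, e1) |: ((a1, e2) |: q0))) => //.
rewrite n3 n2 n1 (cardsD1 (e1, e1) q) e1q (cardsD1 (e2, e2) (q :\ _)) !inE e2q.
by rewrite xpair_eqE andbb eq_sym e12.
Qed.

(** Each of the two ends of [f] lies on at most one of three disjoint edges. *)
Lemma three_apart M (e1 e2 e3 f : medge M) :
    apart e1 e2 -> apart e1 e3 -> apart e2 e3 ->
  [|| apart e1 f, apart e2 f | apart e3 f].
Proof.
move=> a12 a13 a23; have [p [q [_ Df]]] := cards2P _ (introT eqP (card_ends f)).
rewrite -!(apartC f) !(apart2 _ Df).
have H x : [&& (x \in ends e1) ==> (x \notin ends e2),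
               (x \in ends e1) ==> (x \notin ends e3)
             & (x \in ends e2) ==> (x \notin ends e3)].
  by apply/and3P; split; apply/implyP; apply: apartF.
move: (H p) (H q); do 3![case: (p \in _)] => //=; by do 3![case: (q \in _)].
Qed.

(** When all branches are single, the minimum degree provides an edge that avoids
    [v] and is outside the system. *)
Lemma add_high_degree M (A : {set mvertex M}) v q x1 x2 x3 :
    triangle_free M -> (forall u, u \in A -> 1 < #|nbrs A u|) ->
    v \in A -> x1 \in nbrs A v -> x2 \in nbrs A v -> x3 \in nbrs A v ->
    x1 != x2 -> x1 != x3 -> x2 != x3 -> system (A :\ v) q ->
  exists2 q', system A q' & #|q'| = #|q|.+1.
Proof.
move=> tf deg2 vA N1 N2 N3 x12 x13 x23 sq; have [qA qc] := sq.
have Nedge x : x \in nbrs A v ->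
    x \in A /\ exists a : medge M, ends a = [set v; x].
  by rewrite inE => /andP[xA /madjP].
have [xA1 [a1 Da1]] := Nedge _ N1; have [xA2 [a2 Da2]] := Nedge _ N2.
have [xA3 [a3 Da3]] := Nedge _ N3.
have [/'forall_in_existsP cov|] := boolP [forall (x | x \in nbrs A v),
  [exists e, ((e, e) \in q) && (x \in ends e)]]; last first.
  rewrite negb_forall_in => /exists_inP[x xN].
  rewrite negb_exists => /forallP ex.
  have [xA [a Da]] := Nedge x xN; apply: add_single Da _ => // e eq.
  by have := ex e; rewrite eq.
(* From here on every neighbour of [v] lies on a single branch. *)
have {cov} ecov x : x \in nbrs A v -> exists e, (e, e) \in q /\ x \in ends e.
  by move=> xN; have [e /andP[]] := cov x xN; exists e.
have euniq x e e' : (e, e) \in q -> (e', e') \in q ->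
    x \in ends e -> x \in ends e' -> e = e'.
  move=> eq e'q xe; apply: contraTeq => /(single_apart sq eq e'q) /apartF.
  exact.
have ediff x y e e' : x \in nbrs A v -> y \in nbrs A v -> x != y ->
    (e, e) \in q -> (e', e') \in q -> x \in ends e -> y \in ends e' ->
    apart e e'.
  rewrite !inE => /andP[_ vx] /andP[_ vy] xy eq e'q xe ye'.
  apply: (single_apart sq) => //.
  apply/eqP=> ee'; rewrite -{}ee' in ye'; apply: (no_triangle tf vx _ vy).
  by apply/madjP; exists e; apply: madj_ends.
have [e1 [e1q xe1]] := ecov _ N1; have [e2 [e2q xe2]] := ecov _ N2.
have [e3 [e3q xe3]] := ecov _ N3.
have a12 := ediff _ _ _ _ N1 N2 x12 e1q e2q xe1 xe2.
have a13 := ediff _ _ _ _ N1 N3 x13 e1q e3q xe1 xe3.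
have a23 := ediff _ _ _ _ N2 N3 x23 e2q e3q xe2 xe3.
have [/exists_inP[[g h] ghq /= gh]|] :=
  boolP [exists (b | b \in q), b.1 != b.2].
  have ap_gh e : (e, e) \in q -> apart e g || apart e h.
    move=> eq; have: compat (e, e) (g, h).
      by apply: qc => //; apply: contraNneq gh => -[<- <-].
    by case/and5P=> _ _ _ _ /=; case: apart => //=; case: apart.
  have key x y a b e e' : x \in A -> y \in A -> x != y ->
      (e, e) \in q -> (e', e') \in q -> x \in ends e -> y \in ends e' ->
      ends a = [set v; x] -> ends b = [set v; y] -> apart e g -> apart e' h ->
    exists2 q', system A q' & #|q'| = #|q|.+1.
    move=> xA yA xy eq e'q xe ye' Da Db eg e'h.
    apply: (swap_branch vA xA yA xy sq ghq gh Da Db).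
    - exact: apartF eg xe.
    - exact: apartF e'h ye'.
    - by move=> d dq xd; rewrite (euniq _ _ _ dq eq xd xe).
    - by move=> d dq yd; rewrite (euniq _ _ _ dq e'q yd ye').
  have y12 : x2 != x1 by rewrite eq_sym.
  have y13 : x3 != x1 by rewrite eq_sym.
  have y23 : x3 != x2 by rewrite eq_sym.
  (* Each [e_i] is apart from [g] or from [h], and each of [g], [h] is apart
     from some [e_i]; with three indices this leaves two different ones, the
     first apart from [g] and the second from [h]. *)
  have := (three_apart g a12 a13 a23, three_apart h a12 a13 a23).
  move: (ap_gh _ e1q) (ap_gh _ e2q) (ap_gh _ e3q).
  have k12 := key _ _ _ _ _ _ xA1 xA2 x12 e1q e2q xe1 xe2 Da1 Da2.
  have k21 := key _ _ _ _ _ _ xA2 xA1 y12 e2q e1q xe2 xe1 Da2 Da1.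
  have k13 := key _ _ _ _ _ _ xA1 xA3 x13 e1q e3q xe1 xe3 Da1 Da3.
  have k31 := key _ _ _ _ _ _ xA3 xA1 y13 e3q e1q xe3 xe1 Da3 Da1.
  have k23 := key _ _ _ _ _ _ xA2 xA3 x23 e2q e3q xe2 xe3 Da2 Da3.
  have k32 := key _ _ _ _ _ _ xA3 xA2 y23 e3q e2q xe3 xe2 Da3 Da2.
  move: k12 k21 k13 k31 k23 k32.
  case: (apart e1 g); case: (apart e2 g); case: (apart e3 g);
  case: (apart e1 h); case: (apart e2 h); case: (apart e3 h) => //=;
  move=> k12 k21 k13 k31 k23 k32 _ _ _ [] // _ _;
  solve [exact: k12 | exact: k21 | exact: k13 | exact: k31 |
         exact: k23 | exact: k32].
rewrite negb_exists_in => /forall_inP single.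
have {}single b : b \in q -> b.1 = b.2 by move/single; rewrite negbK => /eqP.
(* An unused edge [f] is found at the end [z1] of [e1] other than [x1]. *)
have [z1 De1 xz1] := other_end xe1.
have /and3P[/subsetP e1A _ _] := qA _ e1q.
have : z1 \in A :\ v by apply: e1A; rewrite De1 set22.
case/setD1P=> z1v z1A.
have [w wN wx1] : exists2 w, w \in nbrs A z1 & w != x1.
  have := deg2 z1 z1A; case/card_gt1P=> w [w' [wN w'N ww']].
  have [Dw|] := eqVneq w x1; last by exists w.
  by exists w'; rewrite // -Dw eq_sym.
move: wN; rewrite inE => /andP[wA z1w]; have [f Df] := madjP _ _ z1w.
have vx1 : madj v x1 by move: N1; rewrite inE => /andP[].
have wv : w != v.
  apply/eqP=> wv; rewrite wv madjC in z1w.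
  exact: (no_triangle tf vx1 xz1 z1w).
have fA : ends f \subset A :\ v.
  by rewrite Df sub2set !inE z1v z1A wv wA.
have fNe1 : f != e1.
  apply: (@ends_neq _ _ _ w); rewrite ?Df ?De1 ?set22 // !inE (negPf wx1) /=.
  by rewrite eq_sym madj_neq.
have fq : (f, f) \notin q.
  apply: contra fNe1 => fq; apply/eqP; apply: (euniq z1) => //.
    by rewrite Df set21.
  by rewrite De1 set22.
have key x y a b e e' : x \in A -> y \in A -> x1 != y -> x1 != x -> y != x ->
    (e, e) \in q -> (e', e') \in q -> x \in ends e -> y \in ends e' ->
    ends a = [set v; x] -> ends b = [set v; y] -> apart e1 e -> apart e1 e' ->
    apart e e' -> apart e f ->
  exists2 q', system A q' & #|q'| = #|q|.+1.
  move=> xA yA x1y x1x yx eq e'q xe ye' Da Db e1e e1e' ee' ef.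
  apply: (triple_branch vA xA xA1 yA x1y x1x yx sq e1q e'q single fA fq
            Da Da1 Db xe1 ye').
  - exact: apart_neq.
  - by rewrite apartC in e1e; exact: apartF e1e xe.
  - exact: apartF ee' xe.
  - exact: apartF ef xe.
  - by move=> d dq xd; rewrite (euniq _ _ _ dq eq xd xe).
case/or3P: (three_apart f a12 a13 a23) => [e1f||].
- by have := apartF e1f (x := z1); rewrite De1 Df set22 set21 => /(_ isT).
- by apply: (key x2 x3 a2 a3 e2 e3); rewrite // eq_sym.
- by apply: (key x3 x2 a3 a2 e3 e2); rewrite // apartC.
Qed.

(** * Cycles *)

(** All neighbours of the first vertex of a longest path lie on the path; one of
    them is not its successor and closes a cycle, which is not a triangle.
    The first vertex [x] is also the default of [nth], so that the index
    [size (x :: s)] wraps around to index 0. *)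
Lemma ex_cycle M (A : {set mvertex M}) :
    triangle_free M -> A != set0 -> (forall u, u \in A -> 1 < #|nbrs A u|) ->
  exists x s, [/\ uniq (x :: s), 3 <= size s, {subset x :: s <= A} &
    forall i, i < size (x :: s) ->
      madj (nth x (x :: s) i) (nth x (x :: s) i.+1)].
Proof.
move=> tf /set0Pn[x0 x0A] deg2.
pose P n := [exists t : n.-tuple (mvertex M),
  [&& uniq t, all [in A] t & sorted (@madj M) t]].
have exP : exists n, P n.
  by exists 1; apply/existsP; exists [tuple x0]; rewrite /= x0A.
have ubP n : P n -> n <= #|mvertex M|.
  case/existsP=> t /and3P[/card_uniqP + _ _].
  by rewrite size_tuple => <-; exact: max_card.
case: (ex_maxnP exP ubP) => [[|m]] Pm maxm.
  have /maxm // : P 1.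
  by apply/existsP; exists [tuple x0]; rewrite /= x0A.
case/existsP: Pm => t; case/tupleP: t => x p /and3P[Ut /allP At St].
have xA : x \in A by apply: At; rewrite mem_head.
have Nt y : y \in nbrs A x -> y \in x :: p.
  rewrite inE => /andP[yA xy]; apply: contraT => yt.
  suff /maxm : P m.+2 by rewrite ltnn.
  apply/existsP; exists [tuple of y :: x :: p].
  apply/and3P; split.
  - by rewrite cons_uniq yt.
  - by apply/allP=> z; rewrite inE => /predU1P[->|/At].
  - by rewrite -[sorted _ _]/(madj y x && sorted (@madj M) (x :: p)) madjC xy.
have [y yN y1] : exists2 y, y \in nbrs A x & y != nth x p 0.
  have /card_gt1P[w [w' [wN w'N ww']]] := deg2 x xA.
  have [Dw|] := eqVneq w (nth x p 0); last by exists w.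
  by exists w'; rewrite // -Dw eq_sym.
have yt := Nt y yN; move: yN; rewrite inE => /andP[yA xy].
have yx : y != x by rewrite eq_sym madj_neq.
have yp : y \in p by move: yt; rewrite inE (negPf yx).
pose j := index y p.
have jp : j < size p by rewrite index_mem.
have yj : nth x p j = y by rewrite nth_index.
have j0 : 0 < j.
  by rewrite lt0n; apply: contraNneq y1 => j0; rewrite -yj j0.
have adj_t i : i < size p -> madj (nth x (x :: p) i) (nth x (x :: p) i.+1).
  by move=> ip; have /(sortedP x) := St; apply.
have sz : size (take j.+1 p) = j.+1 by rewrite size_takel.
exists x, (take j.+1 p); rewrite [size (_ :: _)]/= sz; split.
- by have := take_uniq j.+2 Ut.
- rewrite ltnS ltn_neqAle j0 andbT; apply/eqP=> j1.
  have x1 := adj_t 0 (leq_ltn_trans (leq0n _) jp).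
  have := adj_t 1; rewrite [1]j1 /= => /(_ jp) x2; rewrite -j1 /= in x1 x2.
  by apply: (no_triangle tf x1 x2); rewrite j1 yj.
- by move=> z zs; apply: At; exact: mem_take (zs : z \in take j.+2 (x :: p)).
move=> i; rewrite ltnS leq_eqVlt => /orP[/eqP->|ij].
  rewrite [X in madj _ X]nth_default /= ?sz //.
  by rewrite nth_take // yj madjC.
have := adj_t i (leq_ltn_trans (ij : i <= j) jp).
by case: i ij => [|i] ij; rewrite /= !nth_take // ltnW.
Qed.

Lemma system_family M (A : {set mvertex M}) n (b : nat -> branch M) :
    (forall i, i < n -> branch_in A (b i)) ->
    (forall i j, i < j < n -> compat (b i) (b j)) ->
  exists2 q, system A q & #|q| = n.
Proof.
move=> bA bc; have cmp (i j : 'I_n) : i != j -> compat (b i) (b j).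
  rewrite -val_eqE /= neq_ltn => /orP[] ij; last rewrite compatC.
    by apply: bc; rewrite ij ltn_ord.
  by apply: bc; rewrite ij ltn_ord.
exists [set b i | i : 'I_n]; last first.
  rewrite card_imset ?card_ord // => i j bij; apply: contraTeq isT => /cmp.
  by rewrite bij compat_irr.
split=> [_ /imsetP[i _ ->]|_ _ /imsetP[i _ ->] /imsetP[j _ ->] bij].
  exact: bA.
by apply: cmp; apply: contraNneq bij => ->.
Qed.

(** Two edges of a cycle are disjoint unless their indices differ by at most 1
    modulo the length [n].  For [n = 2 * k + 1] with [k >= 2], [E_i] and
    [E_(i+k)] are therefore disjoint; for [i < j], [E_i] and [E_j] are disjoint
    unless [j = i + 1], and then [E_i] and [E_(j+k)] are, at distance [k + 1].
    Without the single branch at index 0 only [k] pairs would fit. *)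
Lemma cycle_system M (x : mvertex M) s :
    uniq (x :: s) -> 3 <= size s ->
    (forall i, i < size (x :: s) ->
       madj (nth x (x :: s) i) (nth x (x :: s) i.+1)) ->
  exists2 q, system [set y in x :: s] q & #|q| = uphalf (size (x :: s)).
Proof.
set u := nth x (x :: s); set n := size (x :: s) => Us n4 adju.
have {}n4 : 3 < n by [].
have [E DE] : exists E : nat -> medge M,
    forall i, i < n -> ends (E i) = [set u i; u i.+1].
  have : forall i : 'I_n, exists e : medge M, ends e = [set u i; u i.+1].
    by move=> i; apply/madjP; apply: adju.
  case/fin_all_exists=> f Df; exists (fun i => f (inord i)) => i ltin.
  by rewrite Df inordK.
have u_in i j : i < n -> j < n ->
    (u i \in ends (E j)) = [|| i == j, i == j.+1 | (i == 0) && (j.+1 == n)].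
  move=> ltin ltjn; rewrite DE // !inE /u nth_uniq //; congr (_ || _).
  case: (j.+1 =P n) => [jn|jn]; last by rewrite andbF orbF nth_uniq // -/n; lia.
  rewrite jn [X in _ == X]nth_default // -[X in _ == X]/(nth x (x :: s) 0).
  by rewrite nth_uniq //; lia.
have E_apart i j : i.+1 < j -> j < n -> (0 < i) || (j.+1 < n) ->
    apart (E i) (E j).
  move=> ltij ltjn wrap; have ltin : i < n by lia.
  by rewrite (apart2 _ (DE i ltin)) !u_in; lia.
have E_neq i j : i < j < n -> E i != E j.
  case/andP=> ltij ltjn; have [<-|ltij2] := eqVneq i.+1 j.
    by apply: (@ends_neq _ _ _ (u i)); rewrite u_in; lia.
  by rewrite eq_sym; apply: (@ends_neq _ _ _ (u j)); rewrite u_in; lia.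
have EA i : i < n -> ends (E i) \subset [set y in x :: s].
  move=> ltin; rewrite DE //; apply/subsetP=> y /set2P[]->; rewrite inE.
    exact: mem_nth.
  have [ltn|len] := ltnP i.+1 n; first exact: mem_nth.
  by rewrite /u nth_default ?mem_head.
case n_odd: (odd n).
  pose k := n./2; have Dn : n = k.*2.+1 by rewrite -[LHS]odd_double_half n_odd.
  have -> : uphalf n = k.+1 by lia.
  apply: (system_family (b := fun i => (E i, E (if i == 0 then 0 else i + k)))).
    move=> [|i] ltik; rewrite /branch_in /= !EA ?eqxx //; try lia.
    by rewrite E_apart ?orbT //; lia.
  move=> i j /andP[ltij ltjk]; have -> : (j == 0) = false by lia.
  have E_neq2 a b : a < n -> b < n -> a != b -> E a != E b.
    move=> an bn; rewrite neq_ltn => /orP[] ab; last rewrite eq_sym.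
      by rewrite E_neq // ab.
    by rewrite E_neq // ab.
  case: (eqVneq i 0) => [->|i0]; rewrite /compat /= !E_neq2 /=; try lia.
    have [->|j1] := eqVneq j 1; last by rewrite E_apart //; lia.
    by rewrite (@E_apart 0 (1 + k)) ?orbT //; lia.
  have [->|j1] := eqVneq j i.+1; last by rewrite E_apart //; lia.
  by rewrite (@E_apart i (i.+1 + k)) ?orbT //; lia.
pose k := n./2; have Dn : n = k.*2 by rewrite -[LHS]odd_double_half n_odd.
have -> : uphalf n = k by lia.
apply: (system_family (b := fun i => (E i.*2, E i.*2))).
  by move=> i ltik; rewrite /branch_in /= !EA ?eqxx //; lia.
move=> i j /andP[ltij ltjk]; rewrite /compat /= !E_neq ?E_apart //; lia.
Qed.

(** The vertices with even index form the cover: by 2-regularity, an edge at a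
    vertex with odd index leads to one of its two neighbours on the cycle, whose
    index is even (also when it wraps around to 0). *)
Lemma cycle_cover M (A T : {set mvertex M}) x s :
    uniq (x :: s) -> 3 <= size s -> {subset x :: s <= A} ->
    (forall u, u \in A -> #|nbrs A u| = 2) ->
    (forall i, i < size (x :: s) ->
       madj (nth x (x :: s) i) (nth x (x :: s) i.+1)) ->
    covers (A :\: [set y in x :: s]) T ->
  exists2 T', covers A T' & #|T'| <= uphalf (size (x :: s)) + #|T|.
Proof.
set u := nth x (x :: s); set n := size (x :: s) => Us n4 sA deg2 adju cT.
have {}n4 : 3 < n by [].
pose T0 := [set u i.*2 | i : 'I_(uphalf n)].
have T0P i : i < n -> ~~ odd i -> u i \in T0.
  move=> ltin i_even; have Di : i = i./2.*2.
    by rewrite -[LHS]odd_double_half (negPf i_even).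
  have lti : i./2 < uphalf n by lia.
  by apply/imsetP; exists (Ordinal lti); rewrite //= -Di.
exists (T0 :|: T); last first.
  apply: leq_trans (leq_card_setU _ _) _; rewrite leq_add2r.
  by apply: leq_trans (leq_imset_card _ _) _; rewrite card_ord.
move=> e eA; have [dK|] := boolP [disjoint ends e & [set y in x :: s]].
  have [|y yT ye] := cT e; first by rewrite subsetD eA.
  by exists y; rewrite // inE yT orbT.
rewrite -setI_eq0 => /set0Pn[y /setIP[ye]]; rewrite inE => /(nthP x)[i ltin Dy].
rewrite -/n -/u in ltin Dy; have [i_odd|i_even] := boolP (odd i); last first.
  by exists y; rewrite // inE -Dy T0P.
have [z De yz] := other_end ye.
have zN : z \in nbrs A y by rewrite inE yz (subsetP eA) // De set22.
have i0 : 0 < i by case: (i) i_odd.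
have Di : i.-1.+1 = i by rewrite prednK.
have lti1 : i.-1 < n by lia.
have u1 : u i.-1 \in nbrs A y.
  by rewrite inE sA ?mem_nth // -Dy madjC -{2}Di adju.
have uiA : u i.+1 \in A.
  have [lt|ge] := ltnP i.+1 n; first by rewrite sA ?mem_nth.
  by rewrite /u nth_default ?sA ?mem_head.
have u2 : u i.+1 \in nbrs A y by rewrite inE uiA -Dy adju.
have un : n <= i.+1 -> u i.+1 = u 0 by move=> ge; rewrite /u nth_default.
have u12 : u i.-1 != u i.+1.
  have [lt|ge] := ltnP i.+1 n.
    by rewrite /u nth_uniq // -{2}Di neq_ltn leqnSn.
  by rewrite un // /u nth_uniq //; clear -n4 ge; lia.
have : z \in [set u i.-1; u i.+1].
  suff <- : nbrs A y = [set u i.-1; u i.+1] by [].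
  apply/esym/eqP; rewrite eqEcard cards2 u12 deg2 ?andbT.
    by apply/subsetP=> w /set2P[]->.
  by rewrite -Dy sA ?mem_nth.
move=> zu; exists z; last by rewrite De set22.
rewrite inE; case/set2P: zu => ->.
  by rewrite T0P //; move: i_odd; rewrite -{1}Di.
have [lt|ge] := ltnP i.+1 n; first by rewrite T0P //= i_odd.
by rewrite un // T0P.
Qed.

(** * Covers no larger than systems *)

(** Restricting to the edges inside [A] lets the induction delete vertices while
    [M] stays fixed.  Each deletion enlarges the system by at least as many
    branches as it adds vertices to the cover. *)
Lemma cover_system M (A : {set mvertex M}) : triangle_free M ->
  exists T q, [/\ covers A T, system A q & #|T| <= #|q|].
Proof.
move=> tf; have [n] := ubnP #|A|; elim: n => // n IH in A * => ltAn.
have IHD (B : {set mvertex M}) y : y \in A -> y \in B ->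
    exists T q, [/\ covers (A :\: B) T, system (A :\: B) q & #|T| <= #|q|].
  move=> yA yB; apply: IH; rewrite -ltnS; apply: leq_trans ltAn.
  rewrite ltnS; apply: proper_card; rewrite properE subsetDl /=.
  by apply/subsetPn; exists y; rewrite // !inE yB.
have [->|A0] := eqVneq A set0.
  exists set0, set0; split; rewrite ?cards0 //; last exact: system0.
  by move=> e; rewrite subset0 -cards_eq0 card_ends.
have [deg2|] := boolP [forall (u | u \in A), 1 < #|nbrs A u|]; last first.
  rewrite negb_forall_in => /exists_inP[v vA]; rewrite -leqNgt => Nv.
  have [N0|N0] := eqVneq (nbrs A v) set0.
    have [T [q [cT sq le]]] := IHD [set v] v vA (set11 v).
    exists T, q; split=> //; first exact: remove_isolated N0 cT.
    by apply: sub_system sq; rewrite ?subsetDl.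
  have /cards1P[u Du] : #|nbrs A v| == 1 by rewrite eqn_leq Nv card_gt0.
  have [T [q [cT sq le]]] := IHD [set u; v] v vA (set22 u v).
  have [cT' [q' sq' Dq']] := remove_leaf vA Du cT sq.
  exists (u |: T), q'; split=> //.
  by rewrite Dq' cardsU1 -add1n leq_add // leq_b1.
have {}deg2 := forall_inP deg2.
have [deg3|] := boolP [exists (v | v \in A), 2 < #|nbrs A v|].
  have [v vA] := exists_inP deg3.
  case/card_gt2P=> x1 [x2 [x3 [[N1 N2 N3] [x12 x23 x31]]]].
  have [T [q [cT sq le]]] := IHD [set v] v vA (set11 v).
  have [|q' sq' Dq'] := add_high_degree tf deg2 vA N1 N2 N3 x12 _ x23 sq.
    by rewrite eq_sym.
  exists (v |: T), q'; split=> //; last first.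
    by rewrite Dq' cardsU1 -add1n leq_add // leq_b1.
  move=> e eA; have [ve|vNe] := boolP (v \in ends e).
    by exists v; rewrite ?setU11.
  have [|y yT ye] := cT e; last by exists y; rewrite // setU1r.
  by rewrite subsetD eA disjoint_sym disjoints1.
rewrite negb_exists_in => /forall_inP deg3.
have deg u : u \in A -> #|nbrs A u| = 2.
  by move=> uA; apply/eqP; rewrite eqn_leq deg2 // leqNgt deg3.
have [x [s [Us s3 sA adjs]]] := ex_cycle tf A0 deg2.
have xA : x \in A by rewrite sA ?mem_head.
have [|T [q [cT sq le]]] := IHD [set y in x :: s] x xA.
  by rewrite inE mem_head.
have [T' cT' leT'] := cycle_cover Us s3 sA deg adjs cT.
have [p sp Dp] := cycle_system Us s3 adjs.
have [|spq Dpq] := systemU _ sp sq.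
  by rewrite -setI_eq0 setIDA setIC -setIDA setDv setI0.
exists T', (p :|: q); split=> //; last by rewrite Dpq Dp; lia.
apply: sub_system spq => //; rewrite subUset subsetDl andbT.
by apply/subsetP=> y; rewrite inE => /sA.
Qed.

(** * Colourings and small models *)

(** Each edge receives a vertex of the cover lying on it as its colour; edges of
    the same colour share that vertex, so they are not adjacent. *)
Lemma cover_colorable M (T : {set mvertex M}) :
  covers [set: mvertex M] T -> colorable (complement (line_graph M)) #|T|.
Proof.
move=> cT; have /fin_all_exists[f Df] : forall e : medge M,
    exists x, x \in T /\ x \in ends e.
  by move=> e; have [x xT xe] := cT e (subsetT _); exists x.
have fT e : f e \in T by case: (Df e).
apply/existsP; exists [ffun e => enum_rank_in (fT e) (f e)].
apply/forallP=> e; apply/forallP=> e'; apply/implyP=> /= /andP[ee'].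
rewrite !ffunE; apply: contraNneq => fee'; apply/andP; split; first exact: ee'.
apply/set0Pn; exists (f e); rewrite inE; case: (Df e) => _ ->.
have -> : f e = f e'; last by case: (Df e').
by have := congr1 enum_val fee'; rewrite !enum_rankK_in.
Qed.

Lemma apart_adj M (e f : medge M) : apart e f ->
  @adj (complement (line_graph M)) e f.
Proof.
move=> ef; rewrite /= /compl_adj /= /line_adj /= apart_neq //=.
by rewrite negbK setI_eq0.
Qed.

Lemma system_model M (A : {set mvertex M}) (q : {set branch M}) : system A q ->
  has_small_model (complete #|q|) (complement (line_graph M)).
Proof.
move=> [qA qc]; pose b (i : 'I_#|q|) := enum_val i.
have bq i : b i \in q by apply: enum_valP.
pose B (i : complete #|q|) : {set complement (line_graph M)} :=
  [set (b i).1; (b i).2].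
have bc i j : i != j -> compat (b i) (b j).
  by move=> ij; apply: qc => //; apply: contraNneq ij => /enum_val_inj->.
apply/existsP; exists [ffun i => B i]; rewrite /is_small /is_model.
apply/andP; split; last first.
  by apply/forallP=> i; rewrite ffunE cards2; case: (_ != _).
apply/and3P; split.
- apply/forallP=> i; rewrite ffunE; apply/andP; split.
    by apply/set0Pn; exists (b i).1; rewrite set21.
  have /and3P[_ _ b12] := qA _ (bq i).
  apply/forall_inP=> e eB; apply/forall_inP=> f fB.
  have [->|ef] := eqVneq e f; first exact: connect0.
  apply: connect1; rewrite /= eB fB /=; apply: apart_adj.
  case/set2P: eB ef => ->; case/set2P: fB => ->; rewrite ?eqxx // => ef.
    by rewrite (negPf ef) in b12.
  by rewrite eq_sym (negPf ef) /= apartC in b12.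
- apply/forallP=> i; apply/forallP=> j.
  apply/implyP=> /bc /and5P[n1 n2 n3 n4 _].
  by rewrite !ffunE disjoints2 !inE !negb_or n1 n2 n3 n4.
apply/forallP=> i; apply/forallP=> j; apply/implyP=> /bc /and5P[_ _ _ _ ap].
have adjB e f : e \in B i -> f \in B j -> apart e f ->
    [exists u in B i, exists v in B j, @adj (complement (line_graph M)) u v].
  move=> eB fB ef; apply/exists_inP; exists e => //.
  apply/exists_inP; exists f => //; exact: apart_adj.
by rewrite !ffunE; case/or4P: ap; apply: adjB; rewrite ?set21 ?set22.
Qed.

Theorem corollary1p7 (M : multigraph) (HM : triangle_free M) :
  had2 (complement (line_graph M)) >= chromatic_number (complement (line_graph M)).
Proof.
have [T [q [cT sq leTq]]] := cover_system [set: mvertex M] HM.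
rewrite /chromatic_number.
case: ex_minnP => k _ /(_ _ (cover_colorable cT)) lekT.
rewrite /had2; case: ex_maxnP => t _ /(_ _ (system_model sq)) leqt.
exact: leq_trans lekT (leq_trans leTq leqt).
Qed.
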